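(* Define $\theta^+,\theta:\{0,1\}^{|J|}\to\mathbb{R}$ by $$\theta^+(x):=\min_{y\in\mathcal{Y}(x)}L^+(x,y),\qquad \theta(x):=\min_{y\in\mathcal{Y}}L(x,y),$$ where $$L^{+}(x,y):=\sum_{i\in I}h_i\,\frac{U^L_i+\sum_{j\in J}w_{ij}x_j}{U^L_i+U^F_i+\sum_{j\in J}w_{ij}(x_j+y_j)},\qquad L(x,y):=\sum_{i\in I}h_i\,\frac{U^L_i+\sum_{j\in J}w_{ij}x_j}{U^L_i+U^F_i+\sum_{j\in J}w_{ij}(x_j\vee y_j)},$$ $$\mathcal{Y}:=\Big\{y\in\{0,1\}^{|J|}:\sum_{j\in J}y_j\le r\Big\},\qquad \mathcal{Y}(x):=\{y\in\mathcal{Y}: y_j\le 1-x_j\ \ \forall j\in J\}.$$ Then $\theta^+(x)=\theta(x)$ for all $x\in\mathcal{X}:=\{x\in\{0,1\}^{|J|}:\sum_{j\in J}x_j\le p\}$.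
   Context: Setting (sequential competitive facility location with a leader L and a follower F). $I$ is a finite nonempty set of customer nodes; $J$ (candidate sites), $J^L$ and $J^F$ (pre-existing facilities of leader and follower) are finite pairwise disjoint sets. Demand weights $h_i\ge 0$ satisfy $\sum_{i\in I}h_i=1$. With real attractiveness levels $\alpha_j$, distances $d_{ij}\geq 0$ and $\beta>0$, set $w_{ij}:=\exp\{\alpha_j-\beta d_{ij}\}>0$ for $i\in I$, $j\in J\cup J^L\cup J^F$, and $U_i^L:=\sum_{j\in J^L}w_{ij}\ge 0$, $U_i^F:=\sum_{j\in J^F}w_{ij}\ge 0$ (these are $0$ if the corresponding set is empty). The budgets $p,r$ are nonnegative integers with $p+r\le |J|$. Notation: $a\vee b:=\max\{a,b\}$. Convention: $0/0:=0$ (this only matters when no facility at all is open for some $i$, i.e. $U_i^L=U_i^F=0$ and $x=y=0$). *)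

(* Defs.v *)
From mathcomp Require Import all_boot all_order all_algebra.
From mathcomp Require Import reals sequences exp.

Set Implicit Arguments.
Unset Strict Implicit.
Unset Printing Implicit Defensive.

Import Order.TTheory GRing.Theory Num.Theory.
Local Open Scope ring_scope.

(* The facility sets J, J^L and J^F are separate finite types and a facility is
   an element of their sum, so that they are pairwise disjoint. *)
Notation facility J JL JF := (J + (JL + JF))%type.
Notation candidate j := (inl j).
Notation leader j := (inr (inl j)).
Notation follower j := (inr (inr j)).

Definition w (R : realType) (I J JL JF : finType)
    (alpha : facility J JL JF -> R) (beta : R) (d : I -> facility J JL JF -> R)
    (i : I) (j : facility J JL JF) : R :=
  expR (alpha j - beta * d i j).

Definition UL (R : realType) (I J JL JF : finType)
    (alpha : facility J JL JF -> R) (beta : R) (d : I -> facility J JL JF -> R)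
    (i : I) : R :=
  \sum_(j : JL) w alpha beta d i (leader j).

Definition UF (R : realType) (I J JL JF : finType)
    (alpha : facility J JL JF -> R) (beta : R) (d : I -> facility J JL JF -> R)
    (i : I) : R :=
  \sum_(j : JF) w alpha beta d i (follower j).

(* 0/1 vectors indexed by J are boolean-valued; entries are read as numbers
   through the coercion from bool to nat and the cast _%:R. *)
Notation binvec J := {ffun J -> bool}.

(* Since z / 0 = 0 in a field, the convention 0/0 := 0 holds for the two
   objectives below. *)
Definition Lplus (R : realType) (I J JL JF : finType) (h : I -> R)
    (alpha : facility J JL JF -> R) (beta : R) (d : I -> facility J JL JF -> R)
    (x y : binvec J) : R :=
  \sum_(i : I) h i *
    ((UL alpha beta d i + \sum_(j : J) w alpha beta d i (candidate j) * (x j)%:R)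
     / (UL alpha beta d i + UF alpha beta d i
        + \sum_(j : J) w alpha beta d i (candidate j)
                       * ((x j)%:R + (y j)%:R))).

Definition L (R : realType) (I J JL JF : finType) (h : I -> R)
    (alpha : facility J JL JF -> R) (beta : R) (d : I -> facility J JL JF -> R)
    (x y : binvec J) : R :=
  \sum_(i : I) h i *
    ((UL alpha beta d i + \sum_(j : J) w alpha beta d i (candidate j) * (x j)%:R)
     / (UL alpha beta d i + UF alpha beta d i
        + \sum_(j : J) w alpha beta d i (candidate j)
                       * Num.max (x j)%:R (y j)%:R)).

Definition X (J : finType) (p : nat) : {set binvec J} :=
  [set x : binvec J | (\sum_(j : J) x j <= p)%N].

Definition Y (J : finType) (r : nat) : {set binvec J} :=
  [set y : binvec J | (\sum_(j : J) y j <= r)%N].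

(* The natural-number subtraction below is not truncated, as x j <= 1. *)
Definition Yx (J : finType) (r : nat) (x : binvec J) : {set binvec J} :=
  [set y in Y J r | [forall j : J, (y j <= 1 - x j)%N]].

Definition binvec0 (J : finType) : binvec J := [ffun=> false].

(* Minimum of f over A, meaningful if binvec0 J \in A, in which case it does
   not depend on the default binvec0 J (see min_overP). *)
Definition min_over (R : realType) (J : finType) (A : {set binvec J})
    (f : binvec J -> R) : R :=
  f [arg min_(y < binvec0 J in A) f y]%O.

Definition thetaplus (R : realType) (I J JL JF : finType) (h : I -> R)
    (alpha : facility J JL JF -> R) (beta : R) (d : I -> facility J JL JF -> R)
    (r : nat) (x : binvec J) : R :=
  min_over (Yx r x) (Lplus h alpha beta d x).

Definition theta (R : realType) (I J JL JF : finType) (h : I -> R)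
    (alpha : facility J JL JF -> R) (beta : R) (d : I -> facility J JL JF -> R)
    (r : nat) (x : binvec J) : R :=
  min_over (Y J r) (L h alpha beta d x).

Lemma min_overP (R : realType) (J : finType) (A : {set binvec J})
    (f : binvec J -> R) (A0 : binvec0 J \in A) :
  (exists2 y, y \in A & min_over A f = f y)
  /\ (forall y, y \in A -> min_over A f <= f y).
Proof.
by rewrite /min_over; case: arg_minP => // y yA fy; split; first exists y.
Qed.

Lemma binvec0_Y (J : finType) (r : nat) : binvec0 J \in Y J r.
Proof. by rewrite inE big1 // => j _; rewrite ffunE. Qed.

Lemma binvec0_Yx (J : finType) (r : nat) (x : binvec J) : binvec0 J \in Yx r x.
Proof.
by rewrite inE binvec0_Y; apply/forallP => j; rewrite ffunE.
Qed.

(* Main.v *)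
(* Removing from y the sites already opened by x keeps y feasible and leaves
   max(x, y) unchanged, and max(x, y) = x + y when x and y are disjoint.  So
   both problems minimise over the same set of objective values. *)

Require Import Defs.
From mathcomp Require Import all_boot all_order all_algebra.
From mathcomp Require Import reals sequences exp.

Set Implicit Arguments.
Unset Strict Implicit.
Unset Printing Implicit Defensive.

Import Order.TTheory GRing.Theory Num.Theory.
Local Open Scope ring_scope.

Definition without (J : finType) (x y : binvec J) : binvec J :=
  [ffun j => y j && ~~ x j].

(** The numerators are identical, and for bits [a], [b] the maximum is [a + (b && ~~ a)], so the
    denominators agree term by term. *)
Lemma L_without (R : realType) (I J JL JF : finType) (h : I -> R)
    (alpha : facility J JL JF -> R) (beta : R) (d : I -> facility J JL JF -> R)
    (x y : binvec J) :
  L h alpha beta d x y = Lplus h alpha beta d x (without x y).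
Proof.
apply: eq_bigr => i _; congr (_ * (_ / (_ + _))).
apply: eq_bigr => j _; congr (_ * _); rewrite ffunE.
by case: (x j); case: (y j);
  rewrite /= ?addr0 ?add0r ?maxxx // ?(max_idPl ler01) ?(max_idPr ler01).
Qed.

Lemma without_Yx (J : finType) (r : nat) (x y : binvec J) :
  y \in Y J r -> without x y \in Yx r x.
Proof.
rewrite !inE => y_le; apply/andP; split.
  apply: leq_trans y_le; apply: leq_sum => j _.
  by rewrite ffunE; case: (y j); case: (x j).
by apply/forallP => j; rewrite ffunE; case: (x j); case: (y j).
Qed.

(** With [L_without], this shows that [L] and [Lplus] coincide on [Yx r x]. *)
Lemma without_id (J : finType) (r : nat) (x y : binvec J) :
  y \in Yx r x -> without x y = y.
Proof.
rewrite inE => /andP[_ /forallP y_le]; apply/ffunP => j; rewrite ffunE.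
by have := y_le j; case: (x j); case: (y j).
Qed.

Theorem theorem2 (R : realType) (I J JL JF : finType) (I_nonempty : (0 < #|I|)%N)
    (h : I -> R) (h_ge0 : forall i : I, 0 <= h i) (h_sum1 : \sum_(i : I) h i = 1)
    (alpha : facility J JL JF -> R) (beta : R) (beta_gt0 : 0 < beta)
    (d : I -> facility J JL JF -> R)
    (d_ge0 : forall (i : I) (j : facility J JL JF), 0 <= d i j)
    (p r : nat) (pr_le : (p + r <= #|J|)%N) :
  forall x : binvec J, x \in X J p ->
    thetaplus h alpha beta d r x = theta h alpha beta d r x.
Proof.
move=> x _; rewrite /thetaplus /theta.
have [[y yYx yE] Lplus_min] :=
  min_overP (Lplus h alpha beta d x) (binvec0_Yx r x).
have [[z zY zE] L_min] := min_overP (L h alpha beta d x) (binvec0_Y J r).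
apply/le_anti/andP; split.
  (* [thetaplus <= theta]: the minimiser [z] of [L], stripped of the sites of [x], competes in
     [Yx r x] with the same value. *)
  by rewrite zE L_without; apply/Lplus_min/without_Yx.
(* [theta <= thetaplus]: the minimiser [y] of [Lplus] is its own stripped form, so [L] has the same
   value there. *)
rewrite yE -(without_id yYx) -L_without; apply: L_min.
by move: yYx; rewrite inE => /andP[].
Qed.
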